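(* Let $(\Omega,\mathcal{F},\mathbf{P})$ be a rich probability space, and let $\mathcal{E}$ be the space of simple (real-valued) random variables on $\Omega$, where almost surely equal random variables are identified. Let $\|\cdot\|$ be a norm on $\mathcal{E}$ with the following properties: (1) if two random variables $X,Y\in\mathcal{E}$ have the same distribution, then $\|X\|=\|Y\|$; (2) if two random variables $X,Y\in\mathcal{E}$ are independent, then $\|XY\|=\|X\|\cdot\|Y\|$. Then there exists $p\in[1,+\infty]$ such that $\|X\|=\|X\|_{L_p}$ for every $X\in\mathcal{E}$.
   Context: A probability space $(\Omega,\mathcal{F},\mathbf{P})$ is called rich if it is possible to define on it one continuous random variable (a real random variable whose distribution has no atoms); one can think of $[0,1]$ with Lebesgue measure. A random variable is simple if it takes only finitely many values. For a random variable $X:\Omega\to\mathbf{R}$, $\|X\|_{L_p}=(\mathbf{E}|X|^p)^{1/p}$ if $1\le p<+\infty$, and $\|X\|_{L_\infty}=\inf\{M : \mathbf{P}(|X|\le M)=1\}$. *)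

(* Defs.v *)
From HB Require Import structures.
From mathcomp Require Import all_boot all_order all_algebra.
From mathcomp Require Import all_classical all_reals all_analysis.

Set Implicit Arguments.
Unset Strict Implicit.
Unset Printing Implicit Defensive.

Import Order.TTheory GRing.Theory Num.Theory.
Import numFieldNormedType.Exports.
Import HBSimple.

Local Open Scope classical_set_scope.
Local Open Scope ring_scope.

Definition atomless d (T : measurableType d) (R : realType)
    (P : probability T R) (X : {RV P >-> R}) : Prop :=
  forall r : R, distribution P X [set r] = 0%E.

Definition rich d (T : measurableType d) (R : realType)
    (P : probability T R) : Prop :=
  exists X : {RV P >-> R}, atomless X.

Definition same_distribution d (T : measurableType d) (R : realType)
    (P : probability T R) (X Y : {RV P >-> R}) : Prop :=
  forall A : set R, measurable A -> distribution P X A = distribution P Y A.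

Definition independent_RV d (T : measurableType d) (R : realType)
    (P : probability T R) (X Y : {RV P >-> R}) : Prop :=
  forall A B : set R, measurable A -> measurable B ->
    P (X @^-1` A `&` Y @^-1` B) = (P (X @^-1` A) * P (Y @^-1` B))%E.

(* Nonnegativity follows from the triangle inequality and homogeneity. *)
Definition is_norm (R : numDomainType) (V : lmodType R) (N : V -> R) : Prop :=
  [/\ forall x y : V, N (x + y) <= N x + N y,
      forall (a : R) (x : V), N (a *: x) = `|a| * N x
    & forall x : V, N x = 0 -> x = 0].

(* Addition and scaling of classes are defined through representatives;
   simpleRV_classD and simpleRV_classZ show that they are
   induced by the pointwise operations. *)
Section simple_rv_quotient.
Context d (T : measurableType d) (R : realType) (P : probability T R).
Implicit Types (X Y Z : {sfun T >-> R}) (a b : R).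

Definition as_eq X Y : bool := `[< X = Y %[ae P] >].

Lemma as_eqP X Y : reflect (X = Y %[ae P]) (as_eq X Y).
Proof. exact: asboolP. Qed.

Lemma as_eq_refl : reflexive as_eq.
Proof. by move=> X; apply/as_eqP; exact: ae_eq_refl. Qed.

Lemma as_eq_sym : symmetric as_eq.
Proof. by move=> X Y; apply/as_eqP/as_eqP => /ae_eq_sym. Qed.

Lemma as_eq_trans : transitive as_eq.
Proof. by move=> Y X Z /as_eqP XY /as_eqP YZ; apply/as_eqP/(ae_eq_trans XY YZ). Qed.

Canonical as_eq_equiv := EquivRel as_eq as_eq_refl as_eq_sym as_eq_trans.

Local Open Scope quotient_scope.

Definition simpleRV : Type := {eq_quot as_eq}.
HB.instance Definition _ := Choice.on simpleRV.
HB.instance Definition _ := EqQuotient.on simpleRV.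

Definition simpleRV_class X : simpleRV := \pi_simpleRV X.

Local Notation cls := simpleRV_class.

Lemma simpleRV_classP X Y : cls X = cls Y <-> X = Y %[ae P].
Proof. by split=> [/eqmodP/as_eqP//|XY]; apply/eqmodP/as_eqP. Qed.

Lemma simpleRV_repr X : repr (cls X) = X %[ae P].
Proof. by apply/simpleRV_classP; rewrite /simpleRV_class reprK. Qed.

Lemma simpleRV_reprK (x : simpleRV) : cls (repr x) = x.
Proof. exact: reprK. Qed.

Definition simpleRV_add (x y : simpleRV) : simpleRV := cls (repr x + repr y).
Definition simpleRV_opp (x : simpleRV) : simpleRV := cls (- repr x).
Definition simpleRV_scale a (x : simpleRV) : simpleRV :=
  cls (scale_sfun a (repr x)).

Lemma simpleRV_addE X Y : simpleRV_add (cls X) (cls Y) = cls (X + Y).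
Proof.
apply/simpleRV_classP; have := simpleRV_repr Y; have := simpleRV_repr X.
by apply: filterS2 => t Xt Yt _; rewrite !sfunD /= Xt// Yt.
Qed.

Lemma simpleRV_oppE X : simpleRV_opp (cls X) = cls (- X).
Proof.
apply/simpleRV_classP; have := simpleRV_repr X.
by apply: filterS => t Xt _; rewrite !sfunN /= Xt.
Qed.

Lemma simpleRV_scaleE a X :
  simpleRV_scale a (cls X) = cls (scale_sfun a X).
Proof.
apply/simpleRV_classP; have := simpleRV_repr X.
by apply: filterS => t Xt _ /=; rewrite Xt.
Qed.

Lemma simpleRV_addA : associative simpleRV_add.
Proof.
move=> x y z; rewrite -(simpleRV_reprK x) -(simpleRV_reprK y).
by rewrite -(simpleRV_reprK z) !simpleRV_addE addrA.
Qed.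

Lemma simpleRV_addC : commutative simpleRV_add.
Proof. by move=> x y; rewrite /simpleRV_add addrC. Qed.

Lemma simpleRV_add0 : left_id (cls 0) simpleRV_add.
Proof. by move=> x; rewrite -(simpleRV_reprK x) simpleRV_addE add0r. Qed.

Lemma simpleRV_addN : left_inverse (cls 0) simpleRV_opp simpleRV_add.
Proof.
by move=> x; rewrite -(simpleRV_reprK x) simpleRV_oppE simpleRV_addE addNr.
Qed.

HB.instance Definition _ := GRing.isZmodule.Build simpleRV
  simpleRV_addA simpleRV_addC simpleRV_add0 simpleRV_addN.

Lemma simpleRV_classD X Y : cls (X + Y) = cls X + cls Y.
Proof. by rewrite -simpleRV_addE. Qed.

Lemma simpleRV_class0 : cls 0 = 0.
Proof. by []. Qed.

Lemma simpleRV_scaleA a b (x : simpleRV) :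
  simpleRV_scale a (simpleRV_scale b x) = simpleRV_scale (a * b) x.
Proof.
rewrite -(simpleRV_reprK x) !simpleRV_scaleE; congr cls.
by apply/sfuneqP => t /=; rewrite -mulrA (mulrC b).
Qed.

Lemma simpleRV_scale1 : left_id 1 simpleRV_scale.
Proof.
move=> x; rewrite -(simpleRV_reprK x) simpleRV_scaleE; congr cls.
by apply/sfuneqP => t /=; rewrite mulr1.
Qed.

Lemma simpleRV_scaleDr : right_distributive simpleRV_scale +%R.
Proof.
move=> a x y; rewrite -(simpleRV_reprK x) -(simpleRV_reprK y).
rewrite -simpleRV_classD !simpleRV_scaleE -simpleRV_classD; congr cls.
by apply/sfuneqP => t /=; rewrite mulrDl.
Qed.

Lemma simpleRV_scaleDl (x : simpleRV) :
  {morph simpleRV_scale^~ x : a b / a + b}.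
Proof.
move=> a b; rewrite -(simpleRV_reprK x) !simpleRV_scaleE -simpleRV_classD.
by congr cls; apply/sfuneqP => t /=; rewrite mulrDr.
Qed.

HB.instance Definition _ := GRing.Zmodule_isLmodule.Build R simpleRV
  simpleRV_scaleA simpleRV_scale1 simpleRV_scaleDr simpleRV_scaleDl.

Lemma simpleRV_classZ a X : cls (scale_sfun a X) = a *: cls X.
Proof. by rewrite -simpleRV_scaleE. Qed.

End simple_rv_quotient.

Arguments same_distribution {d T R} P X Y.
Arguments independent_RV {d T R} P X Y.
Arguments simpleRV {d T R} P.
Arguments simpleRV_class {d T R} P X.

(* Main.v *)
(** The norm of X is unchanged when X is multiplied by a {-1, 1}-valued
    variable, because multiplication by an independent fair sign erases signs
    and multiplies the norm by a nonzero constant; averaging X and X (2 1_E - 1) then shows that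
    restricting X to an event decreases its norm.  Hence t |-> ||1_E||,
    P(E) = t, is nondecreasing and multiplicative, so it is t^(1/p).  The norm
    and the L_p norm therefore agree on indicators.  Splitting X along its m
    values, two such functionals that agree on indicators differ at most by the
    factor m.  Applied to the product of n independent copies of X, which takes
    only polynomially many values in n, this gives equality after taking n-th
    roots. *)

Require Import Defs.
From HB Require Import structures.
From mathcomp Require Import all_boot all_order all_algebra.
From mathcomp Require Import all_classical all_reals all_analysis.
From mathcomp Require Import measurable_realfun ess_sup_inf ring lra.

Set Implicit Arguments.
Unset Strict Implicit.
Unset Printing Implicit Defensive.

Import Order.TTheory GRing.Theory Num.Theory.
Import numFieldNormedType.Exports.
Import HBSimple.

Local Open Scope classical_set_scope.
Local Open Scope ring_scope.

(** * Real-valued probabilities and simple variables *)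

Section simple_probability.
Context d (T : measurableType d) (R : realType) (P : probability T R).
Implicit Types (A B E : set T) (X Y Z : {sfun T >-> R}).

(** Real-valued, so that [lra] and field arithmetic apply; [probE] leads back to the measure. *)
Definition prob (A : set T) : R := fine (P A).

Lemma probE A : measurable A -> (prob A)%:E = P A.
Proof. by move=> mA; rewrite /prob fineK// fin_num_measure. Qed.

Lemma prob_ge0 A : 0 <= prob A.
Proof. exact/fine_ge0/measure_ge0. Qed.

Lemma prob0 : prob set0 = 0.
Proof. by rewrite /prob measure0. Qed.

Lemma probT : prob setT = 1.
Proof. by rewrite /prob probability_setT. Qed.

Lemma probU A B : measurable A -> measurable B -> A `&` B = set0 ->
  prob (A `|` B) = prob A + prob B.
Proof.
move=> mA mB AB0; apply: EFin_inj; rewrite EFinD !probE//;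
  last exact: measurableU.
by rewrite measureU.
Qed.

Lemma prob_setIUD A B : measurable A -> measurable B ->
  prob A = prob (A `&` B) + prob (A `\` B).
Proof.
move=> mA mB; rewrite -probU; [|exact: measurableI|exact: measurableD|].
  by rewrite setUIDK.
by rewrite setDE setIACA setICr setI0.
Qed.

Lemma le_prob A B : measurable A -> measurable B -> A `<=` B ->
  prob A <= prob B.
Proof. by move=> mA mB AB; rewrite -lee_fin !probE// le_measure ?inE. Qed.

Lemma probU_le A B : measurable A -> measurable B ->
  prob (A `|` B) <= prob A + prob B.
Proof.
move=> mA mB; rewrite -lee_fin EFinD !probE//; last exact: measurableU.
exact: measureU2.
Qed.

(** Induction on [s]: the fibre of the head value is split off [A], and on the rest [W] takes its
    values in the tail. *)
Lemma prob_sum_preimage (V : choiceType) (W : T -> V) (s : seq V) A :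
  (forall v, measurable (W @^-1` [set v])) -> measurable A -> uniq s ->
  (forall t, A t -> W t \in s) ->
  prob A = \sum_(v <- s) prob (A `&` W @^-1` [set v]).
Proof.
move=> mW; elim: s A => [|v s IHs] A mA /= => [_ As|/andP[vs us] As].
  by rewrite big_nil [A](_ : _ = set0) ?prob0// -subset0 => t /As.
rewrite big_cons (prob_setIUD mA (mW v)); congr +%R.
rewrite (IHs (A `\` W @^-1` [set v]))//; last 2 first.
- exact: measurableD.
- by move=> t [/As]; rewrite inE => /predU1P[].
rewrite !big_seq; apply: eq_bigr => w ws; congr prob.
apply/seteqP; split=> t /= => [[[]]//|[At Ww]]; split=> //; split=> // Wv.
by move: vs; rewrite -Wv Ww ws.
Qed.

Lemma indic_sfunE E (mE : measurable E) t : indic_sfun E mE t = \1_E t :> R.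
Proof. by []. Qed.

Lemma scale_sfunE (a : R) X t : scale_sfun a X t = a * X t.
Proof. by rewrite mulrC. Qed.

Lemma sfunME X Y t : (X * Y) t = X t * Y t.
Proof. by []. Qed.

Lemma sfunDE X Y t : (X + Y) t = X t + Y t.
Proof. by []. Qed.

Lemma sfun_values X : exists s : seq R,
  [/\ uniq s, forall t, X t \in s & forall x, x \in s -> exists t, X t = x].
Proof.
have /finite_seqP[s sE] := @fimfunP _ _ X.
exists (undup s); split=> [|t|x]; first exact: undup_uniq.
  rewrite mem_undup; have : [set` s] (X t) by rewrite -sE; exists t.
  by [].
rewrite mem_undup => xs; have : [set` s] x by [].
by rewrite -sE => -[t _ <-]; exists t.
Qed.

Lemma probC E : measurable E -> prob (~` E) = 1 - prob E.
Proof.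
move=> mE; have := prob_setIUD (@measurableT _ T) mE.
by rewrite setTI setTD probT; lra.
Qed.

Lemma measurable_oppr_preimage (J : set R) :
  measurable J -> measurable (-%R @^-1` J).
Proof.
have mN : measurable_fun setT (-%R : R -> R) by [].
by move=> mJ; rewrite -[X in measurable X]setTI; exact: mN.
Qed.

Lemma indic_sfun01 E (mE : measurable E) t :
  (indic_sfun E mE : {sfun T >-> R}) t \in [:: 0; 1].
Proof. by rewrite indic_sfunE indicE !inE; case: (t \in E);
  rewrite /= eqxx ?orbT. Qed.

Lemma indic_sfun_fiber1 E (mE : measurable E) :
  (indic_sfun E mE : {sfun T >-> R}) @^-1` [set 1] = E.
Proof.
apply/seteqP; split=> t /=; rewrite indic_sfunE indicE; last by move=> Et;
  rewrite mem_set.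
by have [/set_mem//|_ /eqP] := boolP (t \in E); rewrite eq_sym oner_eq0.
Qed.

Lemma indic_sfun_fiber0 E (mE : measurable E) :
  (indic_sfun E mE : {sfun T >-> R}) @^-1` [set 0] = ~` E.
Proof.
apply/seteqP; split=> t /=; rewrite indic_sfunE indicE; last by move=> nEt;
  rewrite memNset.
by have [_ /eqP|/negP nE _ Et] := boolP (t \in E);
  [rewrite oner_eq0|apply: nE; rewrite inE].
Qed.

End simple_probability.

(** * Events and simple variables of prescribed law *)

Section events_of_given_probability.
Context d (T : measurableType d) (R : realType) (P : probability T R).
Implicit Types (A B E : set T).
Local Notation prob := (prob P).

Lemma prob_bigcup_le (F : (set T)^nat) (t : R) :
  (forall n, measurable (F n)) -> nondecreasing_seq F ->
  (forall n, prob (F n) <= t) -> prob (\bigcup_n F n) <= t.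
Proof.
move=> mF ndF Ft; have mU := bigcup_measurable (fun k (_ : setT k) => mF k).
have cF := nondecreasing_cvg_mu mF mU ndF (mu := P).
rewrite -lee_fin probE// -(cvg_lim _ cF)//; apply: lime_le.
  by apply/cvg_ex; exists (P (\bigcup_n F n)).
by apply: nearW => n; rewrite /= -(probE P (mF n)) lee_fin.
Qed.

Lemma prob_bigcap_ge (F : (set T)^nat) (t : R) :
  (forall n, measurable (F n)) -> nonincreasing_seq F ->
  (forall n, t <= prob (F n)) -> t <= prob (\bigcap_n F n).
Proof.
move=> mF niF Ft.
have mI := bigcap_measurable (ex_intro _ 0%N I) (fun k (_ : setT k) => mF k).
have cF : (P \o F) x @[x --> \oo] --> P (\bigcap_n F n).
  apply: nonincreasing_cvg_mu => //.
  by rewrite (le_lt_trans (probability_le1 P (mF 0%N)))// ltry.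
rewrite -lee_fin probE// -(cvg_lim _ cF)//; apply: lime_ge.
  by apply/cvg_ex; exists (P (\bigcap_n F n)).
by apply: nearW => n; rewrite /= -(probE P (mF n)) lee_fin.
Qed.

(** Intermediate values of the distribution function of an atomless [U], restricted to [A]: right
    continuity at the supremum [r] of the levels of mass at most [t] gives mass at least [t], and
    the left limit together with the absence of an atom at [r] gives mass at most [t]. *)
Lemma exists_subevent A (t : R) : rich P -> measurable A ->
  0 <= t <= prob A -> exists B, [/\ measurable B, B `<=` A & prob B = t].
Proof.
move=> [U aU] mA /andP[]; rewrite le_eqVlt => /predU1P[<- _|t0].
  by exists set0; split; rewrite ?prob0.
rewrite le_eqVlt => /predU1P[->|tA]; first by exists A; split.
have mU (J : set R) : measurable J -> measurable (U @^-1` J).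
  by move=> mJ; rewrite -[X in measurable X]setTI; exact: measurable_funP.
pose F r := A `&` U @^-1` `]-oo, r].
have mF r : measurable (F r) by apply: measurableI => //; exact: mU.
have F_le r s : r <= s -> F r `<=` F s.
  move=> rs x [Ax]; rewrite /= !in_itv/= => Ux; split=> //=.
  by rewrite in_itv/= (le_trans Ux).
pose S := [set r | prob (F r) <= t].
(* Otherwise the events [F (- n)], which decrease to the empty set, would all have probability at
   least [t > 0]. *)
have S0 : S !=set0.
  apply/set0P; apply/negP => /eqP S0.
  have : t <= prob (\bigcap_n F (- n%:R)).
    apply: prob_bigcap_ge => // [m n mn|n].
      by apply/subsetPset/F_le; rewrite lerN2 ler_nat.
    have /negP : ~ S (- n%:R) by rewrite S0.
    by rewrite -ltNge => /ltW.
  rewrite [bigcap _ _](_ : _ = set0) ?prob0 ?leNgt ?t0// -subset0 => x xF.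
  have := xF (Num.bound `|U x|) I; rewrite /F/= in_itv/= => -[_].
  rewrite lerNr leNgt (le_lt_trans (ler_norm _))// normrN.
  exact: archi_boundP.
(* Otherwise the events [F n], which increase to [A], would all have probability at most
   [t < prob A]. *)
have Sub : has_ubound S.
  apply: contrapT => Snub.
  have : prob (\bigcup_n F n%:R) <= t.
    apply: prob_bigcup_le => // [m n mn|n].
      by apply/subsetPset/F_le; rewrite ler_nat.
    have [r Sr nr] : exists2 r, S r & n%:R < r.
      apply: contrapT => nSr; apply: Snub; exists n%:R => r Sr.
      by rewrite leNgt; apply/negP => nr; apply: nSr; exists r.
    by apply: le_trans Sr; apply: le_prob => //; exact/F_le/ltW.
  rewrite leNgt [bigcup _ _](_ : _ = A) ?tA// eqEsubset; split=> x.
    by move=> [n _] [].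
  move=> Ax; exists (Num.bound `|U x|) => //; split=> //=; rewrite in_itv/=.
  by rewrite (le_trans (ler_norm _))// ltW// archi_boundP.
have supS : has_sup S by [].
pose r := sup S.
exists (F r); split=> //; first by move=> x [].
(* Lower bound first: [F r] is the decreasing limit of events whose levels exceed [sup S], hence lie
   outside [S]. *)
apply/eqP; rewrite eq_le; apply/andP; split; last first.
  rewrite (_ : F r = \bigcap_n F (r + n.+1%:R^-1)).
    apply: prob_bigcap_ge => // [m n mn|n].
      by apply/subsetPset/F_le; rewrite lerD2l lef_pV2 ?posrE// ler_nat ltnS.
    rewrite leNgt; apply/negP => /ltW Sn.
    have := ub_le_sup Sub (Sn : S _); rewrite -/r gerDl.
    by rewrite leNgt invr_gt0 ltr0n.
  rewrite eqEsubset; split=> x.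
    by move=> Frx n _; apply: F_le Frx; rewrite lerDl invr_ge0.
  move=> xF; split; first by have [] := xF 0%N I.
  rewrite /= in_itv/=; apply/ler_addgt0Pr => e e0.
  have [n ne] := ltr_add_invr e0.
  have [_] := xF n I; rewrite /= in_itv/= => /le_trans; apply.
  by rewrite lerD2l -[leLHS]add0r ltW.
(* Upper bound: up to the null event where [U] equals [r], [F r] is an increasing union of events
   whose levels lie below some element of [S]. *)
have Fr_le : F r `<=` (\bigcup_n F (r - n.+1%:R^-1)) `|` U @^-1` [set r].
  move=> x [Ax]; rewrite /= in_itv/= le_eqVlt => /predU1P[|Uxr]; first by right.
  left; have [n] := ltr_add_invr Uxr.
  by move=> /ltW nr; exists n => //; split=> //=; rewrite in_itv/= lerBrDr.
have mcup : measurable (\bigcup_n F (r - n.+1%:R^-1)) by exact: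
  bigcup_measurable.
rewrite (le_trans (le_prob _ _ _ Fr_le))//; first by apply: measurableU => //;
  exact: mU.
have U0 : prob (U @^-1` [set r]) = 0 by apply: EFin_inj; rewrite probE;
  [exact: aU|exact: mU].
rewrite (le_trans (probU_le P mcup (mU _ (measurable_set1 r))))//.
rewrite U0 addr0; apply: prob_bigcup_le => // [m n mn|n].
  by apply/subsetPset/F_le; rewrite lerD2l lerN2 lef_pV2 ?posrE// ler_nat ltnS.
have n0 : 0 < n.+1%:R^-1 :> R by rewrite invr_gt0.
have [s Ss sr] := sup_adherent n0 supS.
by apply: le_trans Ss; apply: le_prob => //; exact/F_le/ltW.
Qed.

End events_of_given_probability.

(** * Laws, independence and independent copies of simple variables *)

Section independent_copies.
Context d (T : measurableType d) (R : realType) (P : probability T R).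
Implicit Types (A B E : set T) (X Y Z : {sfun T >-> R}).
Local Notation prob := (prob P).

Lemma measurable_preimage X (J : set R) : measurable J ->
  measurable (X @^-1` J).
Proof. by move=> mJ; rewrite -[X in measurable X]setTI;
  exact: measurable_funP. Qed.

Lemma measurable_fiber X (x : R) : measurable (X @^-1` [set x]).
Proof. exact: measurable_preimage. Qed.
Local Hint Resolve measurable_fiber : core.

Lemma prob_preimage X (s : seq R) (J : set R) E :
  uniq s -> (forall t, X t \in s) -> measurable J -> measurable E ->
  prob (E `&` X @^-1` J) = \sum_(x <- s | x \in J) prob (E `&` X @^-1` [set x]).
Proof.
move=> us sX mJ mE; have mXJ := measurable_preimage X mJ.
rewrite (prob_sum_preimage P (W := X) (s := s))//; last exact: measurableI.
rewrite [RHS]big_mkcond/=; apply: eq_bigr => x _; case: ifPn => [/set_mem Jx|].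
  congr prob; apply/seteqP; split=> t /=; first by move=> [[]].
  by move=> [Et Xt]; split=> //; split=> //; rewrite Xt.
move=> /negP nJx; rewrite (_ : _ `&` _ = set0) ?prob0// -subset0 =>
  t /= [[_ Jt] Xt].
by apply: nJx; rewrite inE -Xt.
Qed.

Lemma prob_preimageT X (s : seq R) (J : set R) :
  uniq s -> (forall t, X t \in s) -> measurable J ->
  prob (X @^-1` J) = \sum_(x <- s | x \in J) prob (X @^-1` [set x]).
Proof.
move=> us sX mJ; rewrite -[X @^-1` J]setTI (prob_preimage us sX)//.
by apply: eq_bigr => x _; rewrite setTI.
Qed.

Lemma same_distributionP X Y (s : seq R) :
  uniq s -> (forall t, X t \in s) -> (forall t, Y t \in s) ->
  (forall x, x \in s -> prob (X @^-1` [set x]) = prob (Y @^-1` [set x])) ->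
  same_distribution P X Y.
Proof.
move=> us sX sY XY J mJ; rewrite /distribution/= /pushforward.
rewrite -!probE; [|exact: measurable_preimage..].
congr EFin; rewrite (prob_preimageT us sX mJ) (prob_preimageT us sY mJ).
by rewrite big_seq_cond [RHS]big_seq_cond; apply: eq_bigr => x /andP[xs _];
  exact: XY.
Qed.

(** Both events are split into fibres; the fibre of a value that [X] does not attain is empty.
    Asking only for attained values fits [exists_conditional_law], which controls the joint law only
    at listed values. *)
Lemma independent_RVP X Y :
  (forall x y, (exists t, X t = x) -> prob (X @^-1` [set x] `&` Y @^-1` [set
    y]) =
    prob (X @^-1` [set x]) * prob (Y @^-1` [set y])) ->
  independent_RV P X Y.
Proof.
move=> XY J K mJ mK; have [sx [usx sX _]] := sfun_values X.
have [sy [usy sY _]] := sfun_values Y.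
have [mX mY] := (measurable_preimage X mJ, measurable_preimage Y mK).
rewrite -!probE//; last exact: measurableI.
rewrite -EFinM; congr EFin; rewrite setIC (prob_preimage usx sX)//.
rewrite (prob_preimageT usx sX)// mulr_suml; apply: eq_bigr => x _.
have [nx|[t Xt]] : (X @^-1` [set x] = set0) \/ exists t, X t = x.
- have [->|/set0P[t]] := eqVneq (X @^-1` [set x]) set0; first by left.
  by right; exists t.
- by rewrite nx setI0 prob0 mul0r.
rewrite setIC (prob_preimage usy sY)// (prob_preimageT usy sY)// mulr_sumr.
by apply: eq_bigr => y _; apply: XY; exists t.
Qed.

(** A subevent is chosen inside each fibre of [Y]; the union over the finite range of [Y] is
    measurable. *)
Lemma exists_subevent_fibers Y A (f : R -> R) : rich P -> measurable A ->
  (forall y, 0 <= f y <= prob (A `&` Y @^-1` [set y])) ->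
  exists B, [/\ measurable B, B `<=` A &
    forall y, prob (B `&` Y @^-1` [set y]) = f y].
Proof.
move=> rP mA fA.
have /choice[F FP] : forall y, exists B, [/\ measurable B,
    B `<=` A `&` Y @^-1` [set y] & prob B = f y].
  by move=> y; apply: exists_subevent => //; exact: measurableI.
exists (\bigcup_(y in range Y) F y); split.
- by apply: fin_bigcup_measurable => [|y _]; [exact: fimfunP|have [] := FP y].
- by move=> t [y _ Ft]; have [_ /(_ _ Ft)[]] := FP y.
move=> y; have [mF FA <-] := FP y; congr prob; apply/seteqP; split=> t.
  by move=> [[z _ Ft]] /= <-; have [_ /(_ _ Ft)[_ /= ->]] := FP z.
by move=> Ft; have [_ /= Yt] := FA _ Ft; split=> //; exists y => //; exists t.
Qed.

(** Induction on the values: an event [B] taking the share [q x] of every fibre of [Y] is carved out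
    of [A] and receives the value [x]; the rest of [A] is treated recursively, and the last value
    takes all that remains. *)
Lemma exists_conditional_law Y (q : R -> R) x (s : seq R) A :
  rich P -> (forall z, 0 <= q z) -> uniq (x :: s) -> measurable A ->
  (forall y, prob (A `&` Y @^-1` [set y]) =
             (\sum_(z <- x :: s) q z) * prob (Y @^-1` [set y])) ->
  exists Z, (forall t, A t -> Z t \in x :: s) /\
    forall z y, z \in x :: s ->
      prob (A `&` Z @^-1` [set z] `&` Y @^-1` [set y]) =
      q z * prob (Y @^-1` [set y]).
Proof.
move=> rP q0; elim: s x A => [|x' s IHs] x A us mA qA.
  exists (cst_sfun x); split=> [t _|z y]; first by rewrite inE.
  rewrite inE => /eqP->; rewrite preimage_cst/= mem_set// setIT qA.
  by rewrite big_seq1.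
have [B [mB BA BY]] : exists B, [/\ measurable B, B `<=` A &
    forall y, prob (B `&` Y @^-1` [set y]) = q x * prob (Y @^-1` [set y])].
  apply: exists_subevent_fibers => // y; rewrite mulr_ge0 ?prob_ge0//= qA.
  by rewrite ler_wpM2r ?prob_ge0// big_cons lerDl sumr_ge0.
move: us; rewrite cons_uniq => /andP[xs us].
have [|y|Z [Zs ZY]] := IHs x' (A `\` B) us; first exact: measurableD.
  have := prob_setIUD P (measurableI _ _ mA (measurable_fiber Y y)) mB.
  rewrite qA big_cons mulrDl [X in _ = prob X + _](_ : _ =
    B `&` Y @^-1` [set y]).
    rewrite BY => /addrI ->; congr prob.
    by apply/seteqP; split=> t /= [[]].
  by apply/seteqP; split=> t /=; [move=> [[]]|move=> [Bt Yt]; split=> //;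
    split=> //; exact: BA].
(* [Z] overwritten by [x] on [B]; only the pointwise formula [Z'E] is kept afterwards. *)
pose Z' : {sfun T >-> R} := Z + (cst_sfun x - Z) * indic_sfun B mB.
have Z'E t : Z' t = Z t + (x - Z t) * \1_B t by [].
move: Z' Z'E => Z' Z'E; exists Z'.
have Z'B t : B t -> Z' t = x.
  by move=> Bt; rewrite Z'E indicE mem_set//= mulr1 subrKC.
have Z'nB t : ~ B t -> Z' t = Z t.
  by move=> nBt; rewrite Z'E indicE memNset//= mulr0 addr0.
split=> [t At|z y].
  have [Bt|nBt] := pselect (B t); first by rewrite Z'B// inE eqxx.
  by rewrite Z'nB// inE Zs ?orbT.
rewrite inE => /predU1P[->|zs].
  rewrite -BY; congr prob; apply/seteqP; split=> t /=; last first.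
    by move=> [Bt Yt]; split=> //; split; [exact: BA|exact: Z'B].
  move=> [[At Zt] Yt]; split=> //; apply: contrapT => nBt.
  by move: xs; rewrite -Zt (Z'nB t nBt) Zs.
rewrite -(ZY z y zs); congr prob; apply/seteqP; split=> t /= [[At Zt] Yt].
  split=> //; have nBt : ~ B t by move=> Bt; move: xs;
    rewrite -(Z'B t Bt) Zt zs.
  by split=> //; rewrite -Z'nB.
by split=> //; case: At => At nBt; rewrite Z'nB.
Qed.

(** Each value of [X] receives its own probability as its share of every fibre of [Y]. The last
    clause, on values rather than on the law, is what later bounds the range of products of
    copies. *)
Lemma exists_independent_copy X Y : rich P -> exists Z,
  [/\ same_distribution P X Z, independent_RV P Z Y &
      forall t, exists u, Z t = X u].
Proof.
move=> rP; have [s [us sX Xs]] := sfun_values X.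
pose q x := prob (X @^-1` [set x]).
have q1 : \sum_(x <- s) q x = 1.
  rewrite -(probT P) (prob_sum_preimage P (W := X) (s := s))//.
  by apply: eq_bigr => x _; rewrite setTI.
(* An empty list of values is impossible, since the masses sum to 1. *)
case: s us sX Xs q1 => [|x s] us sX Xs q1.
  by have := oner_neq0 R; rewrite -q1 big_nil eqxx.
have q0 z : 0 <= q z by exact: prob_ge0.
have [y|Z [Zs ZY]] := exists_conditional_law (Y := Y) rP q0 us measurableT.
- by rewrite setTI q1 mul1r.
have {}Zs t : Z t \in x :: s by exact: Zs.
(* The law of [Z] is recovered by summing the joint law over the values of [Y]. *)
have ZX z : z \in x :: s -> prob (Z @^-1` [set z]) = q z.
  move=> zs; have [sy [usy sY _]] := sfun_values Y.
  rewrite (prob_sum_preimage P (W := Y) (s := sy))//.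
  under eq_bigr do rewrite -[Z @^-1` _]setTI ZY//.
  rewrite -mulr_sumr -[RHS]mulr1 -(probT P); congr *%R.
  rewrite [RHS](prob_sum_preimage P (W := Y) (s := sy))//.
  by apply: eq_bigr => y _; rewrite setTI.
exists Z; split.
- by apply: (same_distributionP us sX Zs) => z zs; rewrite ZX.
- by apply: independent_RVP => z y [t <-]; rewrite ZX// -ZY// setTI.
- by move=> t; have [u <-] := Xs _ (Zs t); exists u.
Qed.

End independent_copies.

(** * The tensor power argument *)

Section tensor_power.

Lemma bernoulli_ineq (R : realDomainType) (x : R) n :
  0 <= x -> 1 + x * n%:R <= (1 + x) ^+ n.
Proof.
move=> x0; elim: n => [|n IHn]; first by rewrite mulr0 addr0 expr0.
rewrite exprS (le_trans _ (ler_wpM2l _ IHn)) ?addr_ge0//.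
have := mulr_ge0 (mulr_ge0 x0 x0) (ler0n R n).
by rewrite -[n.+1]addn1 natrD; lra.
Qed.

(** If [a > b], the powers of [a / b > 1] outgrow every polynomial. The base [n.+2] is the number of
    exponents from 0 to [n.+1] allowed to each value in an [n.+1]-fold product. *)
Lemma le_of_expr_le_poly (R : realType) (a b : R) (c : nat) :
  0 <= a -> 0 <= b ->
  (forall n, a ^+ n.+1 <= (n.+2%:R ^+ c) * b ^+ n.+1) -> a <= b.
Proof.
move=> a0 b0 ab; rewrite leNgt; apply/negP => ba.
have agt0 : 0 < a := le_lt_trans b0 ba.
have [b00|bn0] := eqVneq b 0.
  by have := ab 0%N; rewrite b00 !expr1 mulr0 leNgt agt0.
have bgt0 : 0 < b by rewrite lt_def bn0.
pose r := a / b.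
have r1 : 1 < r by rewrite ltr_pdivlMr// mul1r.
have r0 : 0 <= r by rewrite divr_ge0.
have rn n : r ^+ n.+1 <= n.+2%:R ^+ c.
  by rewrite exprMn exprVn ler_pdivrMr ?exprn_gt0.
(* A root of order one more than the degree [c], so that a linear factor survives the comparison. *)
pose s := r `^ (c.+1%:R^-1).
have sE : s ^+ c.+1 = r by rewrite -powR_mulrn ?powR_ge0// -powRrM mulVf//
  powRr1.
have s1 : 1 < s.
  rewrite ltNge; apply/negP => s1; have := exprn_ile1 c.+1 (powR_ge0 _ _) s1.
  by rewrite sE leNgt r1.
(* Capping [e] at 1 gives [e * (n + 2) <= 1 + e * (n + 1)], which Bernoulli bounds by the power
   [n + 1] of [1 + e], hence of [s]. *)
pose e := Num.min (s - 1) 1.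
have e0 : 0 < e by rewrite lt_min subr_gt0 s1 ltr01.
have e1 : e <= 1 by rewrite ge_min lexx orbT.
have es : 1 + e <= s by rewrite -lerBrDl ge_min lexx.
have en n : e ^+ c.+1 * n.+2%:R <= 1.
  have n0 : 0 < n.+2%:R ^+ c :> R by rewrite exprn_gt0.
  rewrite -(ler_pM2r n0) mul1r -mulrA -exprS -exprMn.
  apply: le_trans (rn n); rewrite -sE exprAC.
  rewrite lerXn2r ?nnegrE ?mulr_ge0 ?exprn_ge0 ?powR_ge0 ?(ltW e0)//.
  apply: (@le_trans _ _ ((1 + e) ^+ n.+1)); last first.
    by rewrite lerXn2r ?nnegrE ?addr_ge0 ?powR_ge0 ?(ltW e0).
  apply: le_trans (bernoulli_ineq _ (ltW e0)).
  by rewrite -[n.+2]addn1 natrD mulrDr mulr1 addrC lerD2r.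
have ec0 : 0 < e ^+ c.+1 by rewrite exprn_gt0.
(* The bound [en] holds for all [n] with a fixed positive coefficient, against the Archimedean
   property. *)
have := en (Num.bound (e ^+ c.+1)^-1); rewrite mulrC -ler_pdivlMr// mul1r.
rewrite leNgt => /negP; apply.
apply: lt_trans (archi_boundP _) _; first by rewrite invr_ge0 ltW.
by rewrite ltr_nat.
Qed.

Context d (T : measurableType d) (R : realType) (P : probability T R).
Implicit Types (A B E : set T) (X Y Z : {sfun T >-> R}).

(** * Comparison of two functionals ordered on indicators *)

Section comparison.
Variables n1 n2 : {sfun T >-> R} -> R.
Hypothesis n1D : forall X Y, n1 (X + Y) <= n1 X + n1 Y.
Hypothesis n1Z : forall a X, n1 (scale_sfun a X) = `|a| * n1 X.
Hypothesis n1_ge0 : forall X, 0 <= n1 X.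
Hypothesis n1_law : forall X Y, same_distribution P X Y -> n1 X = n1 Y.
Hypothesis n1M : forall X Y, independent_RV P X Y -> n1 X * n1 Y <= n1 (X * Y).
Hypothesis n2Z : forall a X, n2 (scale_sfun a X) = `|a| * n2 X.
Hypothesis n2_ge0 : forall X, 0 <= n2 X.
Hypothesis n2_law : forall X Y, same_distribution P X Y -> n2 X = n2 Y.
Hypothesis n2M : forall X Y, independent_RV P X Y -> n2 (X * Y) <= n2 X * n2 Y.
Hypothesis n2_restr : forall X E (mE : measurable E),
  n2 (X * indic_sfun E mE) <= n2 X.
Hypothesis n12 : forall E (mE : measurable E),
  n1 (indic_sfun E mE) <= n2 (indic_sfun E mE).

(** [Y] is the sum of the terms [v * 1_(Y = v)]. By homogeneity and [n12], [n1] of each term is at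
    most its [n2]; that term is a restriction of [Y], so the bound is [n2 Y]. *)
Lemma le_size_values Y (s : seq R) : (forall t, Y t \in s) ->
  n1 Y <= (size s)%:R * n2 Y.
Proof.
move=> sY.
have mY v : measurable (Y @^-1` [set v]) by exact: measurable_fiber.
pose F v := scale_sfun v (indic_sfun _ (mY v)).
have YE : Y = \sum_(v <- undup s) F v.
  apply/sfuneqP => t; rewrite sfun_sum (bigD1_seq
    (Y t)) ?undup_uniq ?mem_undup//.
  rewrite /F scale_sfunE indic_sfunE indicE mem_set// mulr1 big1 => [|v vY].
    by rewrite /= addr0.
  by rewrite /F scale_sfunE indic_sfunE indicE memNset ?mulr0// => Yv;
    rewrite Yv eqxx in vY.
have FY v : n1 (F v) <= n2 Y.
  apply: le_trans (n2_restr Y (mY v)).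
  have -> : Y * indic_sfun _ (mY v) = F v.
    apply/sfuneqP => t; rewrite sfunME scale_sfunE indic_sfunE indicE.
    by have [/set_mem /= ->|] := boolP (t \in _); rewrite ?mulr0.
  by rewrite n1Z n2Z ler_wpM2l.
have n10 : n1 0 = 0.
  have -> : (0 : {sfun T >-> R}) = scale_sfun 0 0 by apply/sfuneqP => t;
    rewrite scale_sfunE mul0r.
  by rewrite n1Z normr0 mul0r.
rewrite {1}YE (@le_trans _ _ (\sum_(v <- undup s) n1 (F v)))//.
  elim: (undup s) => [|v s' IHs]; first by rewrite !big_nil n10.
  by rewrite !big_cons (le_trans (n1D _ _))// lerD2l.
rewrite (@le_trans _ _ (\sum_(v <- undup s) n2 Y))//; first exact: ler_sum.
rewrite big_const_seq count_predT iter_addr_0 -[leLHS]mulr_natl.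
by rewrite ler_wpM2r// ler_nat size_undup.
Qed.

(** Each exponent, not the total degree, is bounded by [k]. This is more than the products of [k]
    entries, but its size is immediate and polynomial in [k]. *)
Definition monomials (s : seq R) k : seq R :=
  [seq \prod_(i < size s) s`_i ^+ f i | f : {ffun 'I_(size s) -> 'I_k.+1}].

Lemma size_monomials s k : size (monomials s k) = (k.+1 ^ size s)%N.
Proof. by rewrite size_image card_ffun !card_ord. Qed.

Lemma mem_monomials1 s x : x \in s -> x \in monomials s 1.
Proof.
move=> xs; have xi : (index x s < size s)%N by rewrite index_mem.
apply/mapP; exists [ffun i => inord (i == Ordinal xi)] ;
  first by rewrite mem_enum.
rewrite (bigD1 (Ordinal xi))//= ffunE eqxx inordK// expr1 nth_index//.
by rewrite big1 ?mulr1// => i /negPf iN; rewrite ffunE iN inordK.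
Qed.

(** The exponent at the index of [x] goes up by one; it stays within the new bound, so [inord] does
    not truncate. *)
Lemma mem_monomialsM s k x y :
  x \in s -> y \in monomials s k -> y * x \in monomials s k.+1.
Proof.
move=> xs /mapP[f _ ->]; have xi : (index x s < size s)%N by rewrite index_mem.
apply/mapP; exists [ffun i => inord (f i + (i == Ordinal xi))] ;
  first by rewrite mem_enum.
rewrite [RHS](eq_bigr (fun i : 'I_(size s) => s`_i ^+ f i * s`_i ^+
  (i == Ordinal xi))).
  rewrite big_split/=; congr *%R.
  rewrite (bigD1 (Ordinal xi))//= eqxx expr1 nth_index//.
  by rewrite big1 ?mulr1// => i /negPf ->.
move=> i _; rewrite ffunE inordK ?exprD//.
by rewrite -(addn1 k.+1) -addSn leq_add ?leq_b1.
Qed.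

(* Multiplying k + 1 independent copies of X raises both functionals to the
   power k + 1, but creates only polynomially many values. *)
Lemma exists_tensor_power X (s : seq R) k : rich P -> (forall t, X t \in s) ->
  exists Y, [/\ forall t, Y t \in monomials s k.+1,
    n1 X ^+ k.+1 <= n1 Y & n2 Y <= n2 X ^+ k.+1].
Proof.
move=> rP sX; elim: k => [|k [Y [Ys n1Y n2Y]]].
  by exists X; split; rewrite ?expr1// => t; exact: mem_monomials1.
have [Z [XZ indZY Zv]] := exists_independent_copy X Y rP.
have indYZ : independent_RV P Y Z.
  by move=> J K mJ mK; rewrite setIC indZY// muleC.
exists (Y * Z); split.
- move=> t; rewrite sfunME; apply: mem_monomialsM => //.
  by have [u ->] := Zv t.
- rewrite exprSr (le_trans _ (n1M indYZ))// -(n1_law XZ).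
  by rewrite ler_wpM2r.
- by rewrite exprSr (le_trans (n2M indYZ))// -(n2_law XZ) ler_wpM2r.
Qed.

(** [le_size_values] is applied to a tensor power, and [le_of_expr_le_poly] removes the polynomial
    factor. The hypotheses on [n1] and [n2] are one-sided, so that the norm and the [L_p] norm can
    each take either role. *)
Lemma multiplicative_le X : rich P -> n1 X <= n2 X.
Proof.
move=> rP; have [s [_ sX _]] := sfun_values X.
apply: (@le_of_expr_le_poly _ _ _ (size s)) => // k.
have [Y [Ys n1Y n2Y]] := exists_tensor_power k rP sX.
rewrite (le_trans n1Y)// (le_trans (le_size_values Ys))//.
by rewrite size_monomials natrX ler_wpM2l// exprn_ge0.
Qed.

End comparison.
End tensor_power.

(** * Multiplicative norms on indicators *)

Section power_functions.
Context (R : realType).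

(** Monotone solutions of Cauchy's equation on the half line are linear. *)
Lemma nondecreasing_additive (g : R -> R) :
  (forall x y, 0 <= x -> 0 <= y -> g (x + y) = g x + g y) ->
  (forall x y, 0 <= x -> x <= y -> g x <= g y) ->
  forall x, 0 <= x -> g x = x * g 1.
Proof.
move=> gD g_le x x0.
have g0 : g 0 = 0 by have := gD 0 0 (lexx _) (lexx _); rewrite addr0; lra.
have gMn y n : 0 <= y -> g (n%:R * y) = n%:R * g y.
  move=> y0; elim: n => [|n IHn]; first by rewrite !mul0r.
  by rewrite -addn1 natrD !mulrDl !mul1r gD ?mulr_ge0// IHn.
have g1 : 0 <= g 1 by rewrite -g0 g_le.
have gn n : g n%:R = n%:R * g 1 by rewrite -[in LHS](mulr1 n%:R) gMn.
(* Both [n * g x] and [n * x * g 1] lie between [m * g 1] and [(m + 1) * g 1], where [m] is the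
   integer part of [n * x]. *)
have bnd n : n%:R * `|g x - x * g 1| <= g 1.
  have nx0 : 0 <= n%:R * x by rewrite mulr_ge0.
  have /andP[mnx nxm] := truncn_itv nx0.
  set m := Num.truncn (n%:R * x) in mnx nxm.
  have h1 := g_le _ _ (ler0n _ m) mnx.
  have h2 := g_le _ _ nx0 (ltW nxm).
  rewrite gn gMn// in h1; rewrite gn gMn// in h2.
  have h3 := ler_wpM2r g1 mnx; have h4 := ler_wpM2r g1 (ltW nxm).
  rewrite -[n%:R]ger0_norm// -normrM ler_norml mulrBr mulrA.
  by move: h2 h4; rewrite -[m.+1]addn1 natrD mulrDl mul1r => h2 h4; lra.
apply/eqP; rewrite -subr_eq0 -normr_eq0; apply/negP => /negP D0.
have {}D0 : 0 < `|g x - x * g 1| by rewrite lt_def D0 normr_ge0.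
have := bnd (Num.bound (g 1 / `|g x - x * g 1|)).
rewrite -ler_pdivlMr// leNgt => /negP; apply; apply: archi_boundP.
by rewrite divr_ge0.
Qed.

(** The substitution [t = expR (- x)] followed by [- ln] turns [f] into a nondecreasing additive
    function [g] on the half line; the exponent is [g 1]. *)
Lemma nondecreasing_multiplicative (f : R -> R) :
  (forall s t, 0 < s <= 1 -> 0 < t <= 1 -> f (s * t) = f s * f t) ->
  (forall s t, 0 < s -> s <= t -> t <= 1 -> f s <= f t) ->
  (forall t, 0 < t <= 1 -> 0 < f t) ->
  exists2 a, 0 <= a & forall t, 0 < t <= 1 -> f t = t `^ a.
Proof.
move=> fM f_le f_gt0; pose g x := - ln (f (expR (- x))).
have ex (x : R) : 0 <= x -> 0 < expR (- x) <= 1.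
  by move=> x0; rewrite expR_gt0 -expR0 ler_expR oppr_le0.
have gD x y : 0 <= x -> 0 <= y -> g (x + y) = g x + g y.
  move=> x0 y0; rewrite /g opprD expRD fM ?ex// lnM ?posrE ?f_gt0 ?ex//.
  by rewrite opprD.
have g_le x y : 0 <= x -> x <= y -> g x <= g y.
  move=> x0 xy; have y0 := le_trans x0 xy.
  rewrite lerN2 ler_ln ?posrE ?f_gt0 ?ex//; apply: f_le; rewrite ?expR_gt0//.
    by rewrite ler_expR lerN2.
  by have /andP[] := ex _ x0.
have gE := nondecreasing_additive gD g_le.
exists (g 1).
  by have := g_le _ _ (lexx 0) ler01; rewrite (gE 0)// mul0r.
move=> t /[dup] /f_gt0 ft0 /andP[t0 t1].
have x0 : 0 <= - ln t by rewrite oppr_ge0 ln_le0.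
have := gE _ x0; rewrite {1}/g opprK lnK ?posrE// => /eqP.
rewrite mulNr eqr_opp => /eqP lnf.
by rewrite /powR gt_eqF// mulrC -lnf lnK ?posrE.
Qed.

End power_functions.

(** * The given norm: invariance under signs, restriction, and values on indicators *)

Section multiplicative_norms.
Context (R : realType) d (T : measurableType d) (P : probability T R).
Variable N : simpleRV P -> R.
Hypothesis rP : rich P.
Hypothesis N_norm : is_norm N.
Hypothesis N_law : forall X Y : {sfun T >-> R}, same_distribution P X Y ->
  N (simpleRV_class P X) = N (simpleRV_class P Y).
Hypothesis N_indep : forall X Y : {sfun T >-> R}, independent_RV P X Y ->
  N (simpleRV_class P (X * Y)) =
  N (simpleRV_class P X) * N (simpleRV_class P Y).
Implicit Types (A B E : set T) (X Y Z : {sfun T >-> R}).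
Local Notation prob := (prob P).
Local Notation nm X := (N (simpleRV_class P X)).

Lemma normD X Y : nm (X + Y) <= nm X + nm Y.
Proof. by case: N_norm => ND _ _; rewrite simpleRV_classD. Qed.

Lemma normZ a X : nm (scale_sfun a X) = `|a| * nm X.
Proof. by case: N_norm => _ NZ _; rewrite simpleRV_classZ. Qed.

Lemma norm0 : nm 0 = 0.
Proof.
have -> : (0 : {sfun T >-> R}) = scale_sfun 0 0.
  by apply/sfuneqP => t; rewrite scale_sfunE mul0r.
by rewrite normZ normr0 mul0r.
Qed.

Lemma norm_ge0 X : 0 <= nm X.
Proof.
have := normD X (scale_sfun (-1) X); rewrite normZ normrN1 mul1r.
have -> : X + scale_sfun (-1) X = 0.
  by apply/sfuneqP => t; rewrite sfunDE scale_sfunE mulN1r subrr.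
by rewrite norm0; lra.
Qed.

Lemma norm_eq0 X : nm X = 0 -> X = 0%R %[ae P].
Proof.
case: N_norm => _ _ N0 /N0 X0; apply: (simpleRV_classP P X 0).1.
by rewrite X0 simpleRV_class0.
Qed.

Lemma norm_indic_null E (mE : measurable E) : prob E = 0 ->
  nm (indic_sfun E mE) = 0.
Proof.
move=> PE0; rewrite -norm0; congr N; apply/simpleRV_classP.
exists E; split => //; first by rewrite -probE// PE0.
move=> t /= nEt; apply: contrapT => nE; apply: nEt => _.
by rewrite indic_sfunE indicE memNset.
Qed.

Lemma norm_indic_gt0 E (mE : measurable E) : 0 < prob E ->
  0 < nm (indic_sfun E mE).
Proof.
move=> PE; rewrite lt_def norm_ge0 andbT; apply/eqP => /norm_eq0[F [mF F0 EF]].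
have : prob E <= prob F.
  apply: le_prob => // t Et; apply: EF => /= /(_ I).
  by rewrite indic_sfunE indicE mem_set// => /eqP; rewrite oner_eq0.
have -> : prob F = 0 by apply: EFin_inj; rewrite probE.
by rewrite leNgt PE.
Qed.

(** The constant 1 is independent of itself, so its norm is a nonzero idempotent. *)
Lemma norm1 : nm 1 = 1.
Proof.
have n1 : 0 < nm 1.
  have := @norm_indic_gt0 setT measurableT; rewrite probT => /(_ ltr01).
  congr (0 < N (simpleRV_class P _)); apply/sfuneqP => t.
  by rewrite indic_sfunE indicE mem_set.
apply: (mulfI (lt0r_neq0 n1)); rewrite mulr1 -N_indep ?mulr1//.
move=> J K mJ mK.
have -> : (1 : {sfun T >-> R}) @^-1` J = if 1 \in J then setT else set0.
  by case: ifPn => [/set_mem|/negP] J1; apply/seteqP; split=> t //= Jt;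
    apply: J1; rewrite inE.
have -> : (1 : {sfun T >-> R}) @^-1` K = if 1 \in K then setT else set0.
  by case: ifPn => [/set_mem|/negP] J1; apply/seteqP; split=> t //= Jt;
    apply: J1; rewrite inE.
by do 2!case: ifP => _; rewrite ?setI0 ?set0I ?setIT ?measure0
  ?probability_setT ?mul0e ?mule0 ?mule1.
Qed.

(** An independent copy of [2 * 1_B - 1], where [B] has probability one half. *)
Lemma exists_fair_sign X : exists Z, [/\ independent_RV P Z X,
  forall t, Z t = 1 \/ Z t = -1,
  prob (Z @^-1` [set 1]) = 2^-1 & prob (Z @^-1` [set -1]) = 2^-1].
Proof.
have [B [mB _ PB]] : exists B, [/\ measurable B, B `<=` setT & prob B = 2^-1].
  by apply: exists_subevent => //; rewrite probT; apply/andP; split; lra.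
pose S : {sfun T >-> R} := scale_sfun 2 (indic_sfun B mB) + cst_sfun (-1).
have SE t : S t = 2 * \1_B t - 1.
  by rewrite sfunDE scale_sfunE indic_sfunE cst_sfunE.
move: S SE => S SE.
have S1 : S @^-1` [set 1] = B.
  apply/seteqP; split=> t /=; rewrite SE indicE.
    have [/set_mem//|_] := boolP (t \in B).
    by rewrite mulr0 sub0r => h; exfalso; lra.
  by move=> Bt; rewrite mem_set// mulr1; lra.
have SN1 : S @^-1` [set -1] = ~` B.
  apply/seteqP; split=> t /=; rewrite SE indicE.
    by move=> + Bt; rewrite mem_set// mulr1 => h; lra.
  by move=> nBt; rewrite memNset// mulr0 sub0r.
have [Z [SZ ZX Zv]] := exists_independent_copy S X rP.
have prZ x : prob (Z @^-1` [set x]) = prob (S @^-1` [set x]).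
  exact: (congr1 fine (esym (SZ _ (measurable_set1 x)))).
exists Z; split=> // [t||].
- have [u ->] := Zv t; rewrite SE indicE.
  by case: (u \in B); [left; rewrite mulr1|right; rewrite mulr0]; lra.
- by rewrite prZ S1.
- rewrite prZ SN1; have := prob_setIUD P (@measurableT _ T) mB.
  by rewrite setTI setTD PB probT; lra.
Qed.

(** The event is split by the sign [Z]: the law of [Z * X] is the average of the laws of [X] and
    [- X]. *)
Lemma prob_signM X Z (J : set R) : measurable J -> independent_RV P Z X ->
  (forall t, Z t = 1 \/ Z t = -1) ->
  prob (Z @^-1` [set 1]) = 2^-1 -> prob (Z @^-1` [set -1]) = 2^-1 ->
  prob ((Z * X) @^-1` J) = 2^-1 * (prob (X @^-1` J) + prob (X @^-1`
    (-%R @^-1` J))).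
Proof.
move=> mJ ZX Zv Z1 ZN1.
have mNJ := measurable_oppr_preimage mJ.
have prZX x K : measurable K ->
    prob (Z @^-1` [set x] `&` X @^-1` K) = prob (Z @^-1` [set x]) * prob
      (X @^-1` K).
  move=> mK; have mXK := measurable_preimage X mK.
  have mZx := measurable_fiber Z x.
  apply: EFin_inj; rewrite EFinM !probE ?ZX//; exact: measurableI.
rewrite mulrDr -{1}Z1 -ZN1 -!prZX// -probU.
- have := sfunME Z X; move: (Z * X) => W WE.
  congr prob; apply/seteqP; split=> t /=; rewrite WE.
    by have [->|->] := Zv t; rewrite ?mul1r ?mulN1r; [left|right].
  by move=> [] [->]; rewrite ?mul1r ?mulN1r.
- by apply: measurableI; [exact: measurable_fiber|exact: measurable_preimage].
- by apply: measurableI; [exact: measurable_fiber|exact: measurable_preimage].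
- rewrite -subset0 => t /= [[-> _] [h _]]; lra.
Qed.

(* Multiplying by an independent fair sign symmetrises the law, which erases
   the signs of X. *)
Lemma norm_flip X E (mE : measurable E) :
  nm (X * (scale_sfun 2 (indic_sfun E mE) - 1)) = nm X.
Proof.
set Y := X * _.
have YE t : Y t = X t * (2 * \1_E t - 1).
  by rewrite /Y sfunME sfunDE scale_sfunE.
move: Y YE => Y YE.
(* [S] is independent of [X] and [S'] of [Y]. They may differ as variables, but they share a law and
   hence a norm. *)
have [S [SX Sv S1 SN1]] := exists_fair_sign X.
have [S' [SY S'v S'1 S'N1]] := exists_fair_sign Y.
have S_law : same_distribution P S S'.
  apply: (@same_distributionP _ _ _ _ _ _ [:: 1; -1]).
  - by rewrite /= inE andbT; apply/eqP => h; lra.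
  - by move=> t; rewrite !inE; have [->|->] := Sv t; rewrite eqxx ?orbT.
  - by move=> t; rewrite !inE; have [->|->] := S'v t; rewrite eqxx ?orbT.
  - by move=> x; rewrite !inE => /orP[/eqP->|/eqP->];
      rewrite ?S1 ?S'1 ?SN1 ?S'N1.
(* [S] vanishes nowhere, so its class is not zero and its norm can be cancelled. *)
have nS : nm S != 0.
  apply/eqP => /norm_eq0[F [mF F0 SF]].
  have : prob setT <= prob F.
    apply: le_prob => // t _; apply: SF => /= /(_ I) St.
    by have [h|h] := Sv t; move: St; rewrite h => /eqP;
      rewrite ?oppr_eq0 oner_eq0.
  have -> : prob F = 0 by apply: EFin_inj; rewrite probE.
  by rewrite probT leNgt ltr01.
apply: (mulfI nS); rewrite -(N_indep SX) (N_law S_law) -(N_indep SY).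
apply: N_law => J mJ.
rewrite /distribution/= /pushforward -!probE; [|exact: measurable_preimage..].
congr EFin; rewrite (prob_signM mJ SX Sv S1 SN1)
  (prob_signM mJ SY S'v S'1 S'N1).
congr *%R.
have mXJ K : measurable K -> measurable (X @^-1` K) by exact:
  measurable_preimage.
have mYJ K : measurable K -> measurable (Y @^-1` K) by exact:
  measurable_preimage.
have mNJ := measurable_oppr_preimage mJ.
(* It remains to compare the symmetrised laws. [Y] is [X] on [E] and [- X] off [E], so off [E] the
   terms for [J] and its reflection are merely exchanged. *)
rewrite (prob_setIUD P (mYJ _ mJ) mE) (prob_setIUD P (mYJ _ mNJ) mE).
rewrite (prob_setIUD P (mXJ _ mJ) mE) (prob_setIUD P (mXJ _ mNJ) mE).
have YXE K : Y @^-1` K `&` E = X @^-1` K `&` E.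
  apply/seteqP; split=> t /= [] + Et; rewrite YE indicE mem_set// => h;
    split=> //.
    by move: h; rewrite mulr1 (_ : 2 - 1 = 1) ?mulr1//; lra.
  by rewrite mulr1 (_ : 2 - 1 = 1) ?mulr1//; lra.
have YXNE K : Y @^-1` K `\` E = X @^-1` (-%R @^-1` K) `\` E.
  apply/seteqP; split=> t /= [] + nEt; rewrite YE indicE memNset// => h;
    split=> //.
    by move: h; rewrite mulr0 sub0r mulrN1.
  by rewrite mulr0 sub0r mulrN1.
rewrite !YXE !YXNE.
have -> : -%R @^-1` (-%R @^-1` J) = J.
  by apply/seteqP; split=> x /=; rewrite opprK.
lra.
Qed.

(** The restriction is the average of [X] and [X * (2 * 1_E - 1)], which have equal norms by
    [norm_flip]. *)
Lemma norm_restrict_le X E (mE : measurable E) : nm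
  (X * indic_sfun E mE) <= nm X.
Proof.
have -> : (X * indic_sfun E mE : {sfun T >-> R}) =
    scale_sfun 2^-1 (X + X * (scale_sfun 2 (indic_sfun E mE) - 1)).
  apply/sfuneqP => t; rewrite scale_sfunE sfunDE !sfunME sfunDE scale_sfunE.
  have -> : (-1 : {sfun T >-> R}) t = -1 by [].
  by rewrite indic_sfunE; lra.
rewrite normZ ger0_norm//; have := normD X (X * (scale_sfun 2
  (indic_sfun E mE) - 1)).
by rewrite norm_flip; lra.
Qed.

Lemma norm_indic_le E F (mE : measurable E) (mF : measurable F) : E `<=` F ->
  nm (indic_sfun E mE) <= nm (indic_sfun F mF).
Proof.
move=> EF; have -> : indic_sfun E mE = indic_sfun F mF * indic_sfun E mE :>
  {sfun T >-> R}.
  apply/sfuneqP => t; rewrite sfunME !indic_sfunE !indicE.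
  have [/set_mem Et|] := boolP (t \in E); last by rewrite mulr0.
  by rewrite mem_set ?mulr1//; exact: EF.
exact: norm_restrict_le.
Qed.

Lemma norm_indic_law E F (mE : measurable E) (mF : measurable F) :
  prob E = prob F -> nm (indic_sfun E mE) = nm (indic_sfun F mF).
Proof.
move=> EF; apply: N_law; apply: (@same_distributionP _ _ _ _ _ _ [:: 0; 1]).
- by rewrite /= inE andbT eq_sym oner_eq0.
- exact: indic_sfun01.
- exact: indic_sfun01.
- move=> x; rewrite !inE => /orP[]/eqP->.
    by rewrite !indic_sfun_fiber0 !probC// EF.
  by rewrite !indic_sfun_fiber1.
Qed.

(** A copy [Z] of the indicator of [E], independent of that of [F], is again 0-1 valued; its product
    with the indicator of [F] is the indicator of an event as probable as [G]. *)
Lemma norm_indic_mul E F G (mE : measurable E) (mF : measurable F)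
  (mG : measurable G) :
  prob G = prob E * prob F ->
  nm (indic_sfun G mG) = nm (indic_sfun E mE) * nm (indic_sfun F mF).
Proof.
move=> GEF.
have [Z [EZ ZF Zv]] := exists_independent_copy (indic_sfun E mE)
  (indic_sfun F mF) rP.
have mZ : measurable (Z @^-1` [set 1]) by exact: measurable_fiber.
have PZ : prob (Z @^-1` [set 1]) = prob E.
  rewrite -[in RHS](indic_sfun_fiber1 R mE).
  exact: (congr1 fine (esym (EZ _ (measurable_set1 1)))).
rewrite (N_law EZ) -N_indep//.
have -> : Z * indic_sfun F mF = indic_sfun _ (measurableI _ _ mZ mF) :> {sfun T
  >-> R}.
  apply/sfuneqP => t; rewrite sfunME !indic_sfunE !indicE in_setI.
  have [u Zu] := Zv t; have := indic_sfun01 R mE u;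
    rewrite -Zu !inE => /orP[]/eqP Zt.
    rewrite Zt mul0r (_ : t \in Z @^-1` [set 1] = false)//.
    by apply: memNset => /=; rewrite Zt => /eqP; rewrite eq_sym oner_eq0.
  by rewrite Zt mul1r (_ : t \in Z @^-1` [set 1] = true)//; apply: mem_set.
apply: norm_indic_law; rewrite GEF -PZ; apply: EFin_inj; rewrite EFinM !probE//.
  have := ZF _ _ (measurable_set1 1) (measurable_set1 1).
  by rewrite indic_sfun_fiber1 => ->.
exact: measurableI.
Qed.

(** Multiplicativity and monotonicity in the probability give the power law. Null events are set
    apart because their indicators have norm 0, while 0 to the power 0 is 1. *)
Lemma norm_indicE : exists2 a : R, 0 <= a <= 1 &
  forall E (mE : measurable E), 0 < prob E -> nm (indic_sfun E mE) =
    prob E `^ a.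
Proof.
have /choice[B BP] (t : R) : exists B : set T,
  measurable B /\ (0 < t <= 1 -> prob B = t).
  have [t01|] := boolP (0 < t <= 1); last by exists set0; split.
  have [|B [mB _ PB]] := @exists_subevent _ _ _ P setT t rP measurableT.
    by rewrite probT; case/andP : t01 => /ltW -> ->.
  by exists B.
pose f t := nm (indic_sfun _ (BP t).1).
have fE E (mE : measurable E) : 0 < prob E -> nm (indic_sfun E mE) = f (prob E).
  move=> E0; apply: norm_indic_law; rewrite (BP _).2// E0 -(probT P).
  exact: le_prob.
have [s t s01 t01|s t s0 st t1|t t01|a a0 fa] :=
  @nondecreasing_multiplicative R f.
- apply: norm_indic_mul; rewrite !(BP _).2//.
  by case/andP : s01 => s0 s1; case/andP : t01 => t0 t1;
    rewrite mulr_gt0// mulr_ile1// ltW.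
- have t01 : 0 < t <= 1 by rewrite (lt_le_trans s0).
  (* The chosen [B s] need not lie inside [B t], so a subevent of [B t] of probability [s] replaces
     it. *)
  have [|E [mE EB PE]] := @exists_subevent _ _ _ P (B t) s rP (BP t).1.
    by rewrite (BP t).2// ltW.
  by rewrite -PE -fE ?PE//; exact: norm_indic_le.
- by apply: norm_indic_gt0; rewrite (BP t).2//; case/andP : t01.
have fa' E (mE : measurable E) : 0 < prob E ->
  nm (indic_sfun E mE) = prob E `^ a.
  by move=> E0; rewrite fE// fa// E0 -(probT P) le_prob.
exists a => //; rewrite a0/=.
(* The bound [a <= 1] comes from the triangle inequality for an event of probability one half and
   its complement: 1 is at most twice the power [a] of one half. *)
have half01 : 0 < (2^-1 : R) <= 1 by apply/andP; split; lra.
have mB := (BP 2^-1).1; have PB := (BP 2^-1).2 half01.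
have := normD (indic_sfun _ mB) (indic_sfun _ (measurableC mB)).
rewrite !fa' ?probC// ?PB//; last by lra.
have -> : indic_sfun _ mB + indic_sfun _ (measurableC mB) =
  (1 : {sfun T >-> R}).
  apply/sfuneqP => t; rewrite sfunDE !indic_sfunE !indicE in_setC.
  by case: (t \in _); rewrite ?addr0 ?add0r.
rewrite norm1 (_ : 1 - 2^-1 = 2^-1); last by lra.
move=> h; have : ln 2^-1 <= ln (2^-1 `^ a) :> R.
  by rewrite ler_ln ?posrE ?powR_gt0 ?invr_gt0//; lra.
by rewrite ln_powR ler_nMl// ln_lt0//; apply/andP; split; lra.
Qed.

End multiplicative_norms.

(** * L_p norms of simple variables *)

Section Lnorm_simple.
Context d (T : measurableType d) (R : realType) (P : probability T R).
Implicit Types (A B E : set T) (X Y Z : {sfun T >-> R}).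
Local Notation prob := (prob P).

(** [W] may take values in any [choiceType], so that [momentM] can use the pair of two variables. *)
Lemma integral_finite_values (V : choiceType) (W : T ->
  V) (s : seq V) (g : V -> R) :
  (forall v, measurable (W @^-1` [set v])) -> uniq s -> (forall t, W t \in s) ->
  (forall v, 0 <= g v) ->
  (\int[P]_t (g (W t))%:E = (\sum_(v <- s) g v * prob (W @^-1` [set v]))%:E)%E.
Proof.
move=> mW us sW g0.
transitivity (\int[P]_t (\sum_(v <- s) (g v * \1_(W @^-1` [set v]) t)%:E))%E.
  apply: eq_integral => t _; rewrite sumEFin; congr EFin.
  rewrite (bigD1_seq (W t))//= indicE mem_set// mulr1 big1 ?addr0// => v vW.
  by rewrite indicE memNset ?mulr0// => Wv; rewrite -Wv eqxx in vW.
rewrite ge0_integral_sum//; last 2 first.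
- by move=> v; apply/measurable_EFinP/measurable_funM.
- by move=> v t _; rewrite lee_fin mulr_ge0.
rewrite -sumEFin; apply: eq_bigr => v _; under eq_integral do rewrite EFinM.
rewrite ge0_integralZl_EFin//; last exact/measurable_EFinP.
by rewrite integral_indic// setIT EFinM probE.
Qed.

Definition moment (r : R) X := fine (\int[P]_t (`|X t| `^ r)%:E)%E.

Lemma momentE (r : R) X (s : seq R) : uniq s -> (forall t, X t \in s) ->
  moment r X = \sum_(x <- s) `|x| `^ r * prob (X @^-1` [set x]).
Proof.
move=> us sX; rewrite /moment.
by rewrite (@integral_finite_values _ X s (fun x => `|x| `^ r))//.
Qed.

Lemma moment_ge0 (r : R) X : 0 <= moment r X.
Proof. by apply: fine_ge0; apply: integral_ge0 => t _;
  rewrite lee_fin powR_ge0. Qed.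

Lemma LnormE (r : R) X : 'N[P]_r%:E[EFin \o X]%E = (moment r X `^ r^-1)%:E.
Proof.
rewrite unlock.
have [s [us sX _]] := sfun_values X.
rewrite -poweR_EFin /moment.
by rewrite (@integral_finite_values _ X s (fun x => `|x| `^ r))//.
Qed.

Lemma moment_law (r : R) X Y : same_distribution P X Y ->
  moment r X = moment r Y.
Proof.
move=> XY; have [sx [usx sX _]] := sfun_values X;
  have [sy [usy sY _]] := sfun_values Y.
pose s := undup (sx ++ sy); have us : uniq s := undup_uniq _.
rewrite !(@momentE r _ s)//; last 2 first.
- by move=> t; rewrite mem_undup mem_cat sY orbT.
- by move=> t; rewrite mem_undup mem_cat sX.
apply: eq_bigr => x _; congr *%R.
exact: (congr1 fine (XY _ (measurable_set1 x))).
Qed.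

(** The integral is a sum over the joint fibres of the pair, whose probabilities factor by
    independence. *)
Lemma momentM (r : R) X Y : independent_RV P X Y ->
  moment r (X * Y) = moment r X * moment r Y.
Proof.
move=> XY; have [sx [usx sX _]] := sfun_values X;
  have [sy [usy sY _]] := sfun_values Y.
rewrite (momentE r usx sX) (momentE r usy sY).
have fibE v : (fun t => (X t, Y t)) @^-1` [set v] =
  X @^-1` [set v.1] `&` Y @^-1` [set v.2].
  by apply/seteqP; split=> t /=; [move=> <-|case: v => x y /= [-> ->]].
have mXY v : measurable ((fun t => (X t, Y t)) @^-1` [set v]).
  by rewrite fibE; apply: measurableI; exact: measurable_fiber.
rewrite /moment (@integral_finite_values _ (fun t =>
  (X t, Y t)) (allpairs pair sx sy)
  (fun v => `|v.1 * v.2| `^ r))//; last 2 first.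
- by apply: allpairs_uniq => // -[? ?] [? ?] _ _ [-> ->].
- by move=> t; apply/allpairsP; exists (X t, Y t); split=> /=.
rewrite big_allpairs/= mulr_suml; apply: eq_bigr => x _.
rewrite mulr_sumr; apply: eq_bigr => y _.
rewrite normrM powRM// mulrACA; congr *%R; rewrite fibE /=.
apply: EFin_inj; rewrite EFinM !probE; [|exact: measurable_fiber..|].
  exact: XY.
by apply: measurableI; exact: measurable_fiber.
Qed.

(** For [r = 0] the value 0 would also contribute, as 0 to the power 0 is 1. *)
Lemma moment_indic (r : R) E (mE : measurable E) : r != 0 ->
  moment r (indic_sfun E mE) = prob E.
Proof.
move=> r0; rewrite (@momentE r _ [:: 0; 1]); last 2 first.
- by rewrite /= inE andbT eq_sym oner_eq0.
- exact: indic_sfun01.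
rewrite big_cons big_seq1 normr0 powR0// mul0r add0r normr1 powR1 mul1r.
by rewrite indic_sfun_fiber1.
Qed.

(** The essential supremum is the infimum of the almost sure bounds, and being such a bound depends
    only on the law: it says that the law gives no mass to the values of larger modulus. *)
Lemma ess_sup_law X Y : same_distribution P X Y ->
  (ess_sup P (abse \o (EFin \o X)) = ess_sup P (abse \o (EFin \o Y)))%E.
Proof.
move=> XY; rewrite !ess_supEae; congr ereal_inf; apply/seteqP.
suff aux (X' Y' : {sfun T >-> R}) : same_distribution P X' Y' ->
    [set y | \forall t \ae P, (abse \o (EFin \o X')) t <= y]%E `<=`
    [set y | \forall t \ae P, (abse \o (EFin \o Y')) t <= y]%E.
  by split; apply: aux => // J mJ; rewrite XY.
move=> XY' y /= [F [mF F0 XF]].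
have mJ : measurable [set x : R | ~ (`|x|%:E <= y)%E].
  case: y {XF} => [y| |].
  - rewrite (_ : [set _ | _] = ~` [set x | x \in `[-y, y]]).
      by apply: measurableC; exact: measurable_itv.
    by apply/seteqP; split=> x /=; rewrite lee_fin in_itv/= ler_norml.
  - by rewrite (_ : [set _ | _] = set0)// -subset0 => x /=; rewrite leey.
  - by rewrite (_ : [set _ | _] = setT)//; apply/seteqP; split.
exists (Y' @^-1` [set x : R | ~ (`|x|%:E <= y)%E]); split => //.
- exact: measurable_preimage.
- rewrite (_ : P _ = P (X' @^-1` [set x : R | ~ (`|x|%:E <= y)%E]));
    last exact: esym (XY' _ mJ).
  apply/eqP; rewrite eq_le measure_ge0 andbT -F0.
  by apply: le_measure; rewrite ?inE//; exact: measurable_preimage.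
Qed.

End Lnorm_simple.

(** * The [L_p] norm as a functional on simple variables, for [p] finite or infinite *)

Section Lnorm_functional.
Context d (T : measurableType d) (R : realType) (P : probability T R).
Implicit Types (A B E : set T) (X Y Z : {sfun T >-> R}) (p : \bar R).
Local Notation prob := (prob P).
Local Notation moment := (moment P).

Lemma LnormyE X : 'N[P]_+oo[EFin \o X]%E = ess_sup P (abse \o (EFin \o X)).
Proof.
have PT : (0 < P [set: T])%E by rewrite probability_setT.
by rewrite unlock ifT.
Qed.

Lemma EFin_moment (r : R) X : (moment r X)%:E = (\int[P]_t (`|X t| `^ r)%:E)%E.
Proof.
have [s [us sX _]] := sfun_values X; rewrite /moment.
by rewrite (@integral_finite_values _ _ _ _ _ X s (fun x => `|x| `^ r)).
Qed.

Lemma Lnorm_fin_num p X : (1 <= p)%E -> ('N[P]_p[EFin \o X])%E \is a fin_num.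
Proof.
case: p => [r _| _|//]; first by rewrite LnormE.
rewrite ge0_fin_numE ?Lnorm_ge0// LnormyE; have [s [us sX _]] := sfun_values X.
(* Any finite bound will do; the sum of the moduli of all values dominates each of them. *)
apply: (@le_lt_trans _ _ (\sum_(x <- s) `|x|)%:E); last exact: ltry.
apply/ess_supP/nearW => t /=; rewrite lee_fin (bigD1_seq (X t))//=.
by rewrite lerDl sumr_ge0.
Qed.

Lemma Lnorm_le p X Y : (1 <= p)%E -> (forall t, `|X t| <= `|Y t|) ->
  ('N[P]_p[EFin \o X] <= 'N[P]_p[EFin \o Y])%E.
Proof.
case: p => [r r1|_|//] XY; last first.
  by rewrite !LnormyE; apply: le_ess_sup; apply: nearW => t /=; rewrite lee_fin.
have r0 : 0 <= r by rewrite (le_trans ler01).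
rewrite !LnormE lee_fin ge0_ler_powR ?invr_ge0 ?nnegrE ?moment_ge0//.
rewrite -lee_fin !EFin_moment; apply: ge0_le_integral => //.
- apply/measurable_EFinP.
  by apply: (measurableT_comp (measurable_powR r)); exact: measurableT_comp.
- apply/measurable_EFinP.
  by apply: (measurableT_comp (measurable_powR r)); exact: measurableT_comp.
- by move=> t _; rewrite lee_fin ge0_ler_powR ?nnegrE.
Qed.

Lemma Lnorm_scale p a X : (1 <= p)%E ->
  ('N[P]_p[EFin \o scale_sfun a X] = `|a|%:E * 'N[P]_p[EFin \o X])%E.
Proof.
move=> p1; have XL : (X : T -> R) \in Lfun P p.
  rewrite inE; apply/andP; split; rewrite inE; first exact: measurable_funP.
  by have := Lnorm_fin_num X p1; rewrite ge0_fin_numE ?Lnorm_ge0.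
rewrite -(LnormZ (Lfun_Sub p1 XL) a); apply: eq_Lnorm => t /=.
by rewrite mulrC.
Qed.

Lemma Lnorm_law p X Y : (1 <= p)%E -> same_distribution P X Y ->
  ('N[P]_p[EFin \o X] = 'N[P]_p[EFin \o Y])%E.
Proof.
case: p => [r _|_|//] XY; last by rewrite !LnormyE; exact: ess_sup_law.
by rewrite !LnormE (moment_law r XY).
Qed.

Lemma LnormM (r : R) X Y : independent_RV P X Y ->
  ('N[P]_r%:E[EFin \o (X * Y)%R] = 'N[P]_r%:E[EFin \o X] * 'N[P]_r%:E[EFin \o
    Y])%E.
Proof. by move=> XY; rewrite !LnormE momentM// powRM ?moment_ge0. Qed.

(** The almost sure bounds of the two factors multiply. This direction serves when the [L_p] norm
    plays the role of [n2]. *)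
Lemma LnormyM_le X Y :
  ('N[P]_+oo[EFin \o (X * Y)%R] <= 'N[P]_+oo[EFin \o X] * 'N[P]_+oo[EFin \o
    Y])%E.
Proof.
rewrite !LnormyE; apply/ess_supP.
apply: filterS2 (ess_sup_ge P (abse \o (EFin \o X))) (ess_sup_ge P (abse \o
  (EFin \o Y))).
move=> t /= Xt Yt; rewrite normrM EFinM.
by apply: lee_pmul => //; rewrite lee_fin.
Qed.

Lemma Lnorm_indic (r : R) E (mE : measurable E) : r != 0 ->
  ('N[P]_r%:E[EFin \o indic_sfun E mE] = (prob E `^ r^-1)%:E)%E.
Proof. by move=> r0; rewrite LnormE moment_indic. Qed.

(** If the essential supremum were below 1, [E] would be contained in a null event. *)
Lemma Lnormy_indic_ge1 E (mE : measurable E) : 0 < prob E ->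
  (1 <= 'N[P]_+oo[EFin \o indic_sfun E mE])%E.
Proof.
move=> PE; rewrite LnormyE leNgt; apply/negP => lt1.
have [F [mF F0 EF]] := ess_sup_ge P (abse \o (EFin \o indic_sfun E mE)).
have : prob E <= prob F.
  apply: le_prob => // t Et; apply: EF.
  change (~ (`|(indic_sfun E mE : {sfun T >-> R}) t|%:E <= ess_sup P
    (abse \o (EFin \o indic_sfun E mE)))%E).
  by rewrite indic_sfunE indicE mem_set// normr1 => /(lt_le_trans lt1);
    rewrite ltxx.
have -> : prob F = 0 by apply: EFin_inj; rewrite probE.
by rewrite leNgt PE.
Qed.

End Lnorm_functional.

(** * Identification of the norm with an [L_p] norm *)

Theorem theorem1p2 (R : realType) (d : measure_display)
    (T : measurableType d) (P : probability T R) (N : simpleRV P -> R) :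
  rich P ->
  is_norm N ->
  (forall X Y : {sfun T >-> R}, same_distribution P X Y ->
     N (simpleRV_class P X) = N (simpleRV_class P Y)) ->
  (forall X Y : {sfun T >-> R}, independent_RV P X Y ->
     N (simpleRV_class P (X * Y)) =
     N (simpleRV_class P X) * N (simpleRV_class P Y)) ->
  exists p : \bar R, (1 <= p)%E /\
    forall X : {sfun T >-> R},
      (N (simpleRV_class P X))%:E = 'N[P]_p[EFin \o X]%E.
Proof.
move=> rP N_norm N_law N_indep.
have [a /andP[a0 a1] Na] := norm_indicE rP N_norm N_law N_indep.
(* The [L_p] norm of an indicator is its probability to the power [1 / p], so [p] is the inverse of
   [a], with [a = 0] corresponding to the essential supremum. *)
pose p : \bar R := if a == 0 then +oo%E else (a^-1)%:E.
have p1 : (1 <= p)%E.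
  rewrite /p; case: eqVneq => [_|an0]; first exact: leey.
  by rewrite lee_fin invr_ge1 ?unitfE// lt_def an0.
pose L (X : {sfun T >-> R}) : R := fine ('N[P]_p[EFin \o X])%E.
have LE X : (L X)%:E = ('N[P]_p[EFin \o X])%E by rewrite fineK// Lnorm_fin_num.
have L0 X : 0 <= L X by exact/fine_ge0/Lnorm_ge0.
have LZ c X : L (scale_sfun c X) = `|c| * L X.
  by apply: EFin_inj; rewrite EFinM !LE Lnorm_scale.
have L_law (X Y : {sfun T >-> R}) : same_distribution P X Y -> L X = L Y.
  by move=> XY; apply: EFin_inj; rewrite !LE (Lnorm_law p1 XY).
have LM_le (X Y : {sfun T >-> R}) : independent_RV P X Y ->
  L (X * Y) <= L X * L Y.
  move=> XY; rewrite -lee_fin EFinM !LE /p; case: ifP => _;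
    first exact: LnormyM_le.
  by rewrite LnormM.
have L_restr X E (mE : measurable E) : L (X * indic_sfun E mE) <= L X.
  rewrite -lee_fin !LE Lnorm_le// => t.
  rewrite sfunME indic_sfunE indicE normrM ler_piMr//.
  by case: (t \in E); rewrite ?normr0 ?normr1.
have NL_indic E (mE : measurable E) :
    N (simpleRV_class P (indic_sfun E mE)) <= L (indic_sfun E mE).
  have [PE0|PEn0] := eqVneq (prob P E) 0; first by rewrite
    (norm_indic_null N_norm).
  have PE : 0 < prob P E by rewrite lt_def PEn0 prob_ge0.
  rewrite -lee_fin Na// LE /p; case: eqVneq => [->|an0].
    by rewrite powRr0 Lnormy_indic_ge1.
  by rewrite Lnorm_indic ?invr_eq0// invrK.
have NL X : N (simpleRV_class P X) <= L X.
  apply: (@multiplicative_le _ _ _ P (fun X => N (simpleRV_class P X)) L) => //.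
  - exact: normD.
  - exact: normZ.
  - exact: norm_ge0.
  - by move=> Y Z YZ; rewrite N_indep.
exists p; split=> // X; rewrite -LE; congr EFin; apply/eqP; rewrite eq_le NL/=.
(* Reverse inequality. For finite [p] the roles of the two functionals are exchanged; for [a = 0] a
   direct argument follows. *)
have [az|an0] := eqVneq a 0; last first.
  have pE : p = (a^-1)%:E by rewrite /p (negPf an0).
  apply: (@multiplicative_le _ _ _ P L (fun X => N (simpleRV_class P X))) => //.
  - move=> Y Z; rewrite -lee_fin EFinD !LE.
    by apply: eminkowski => //; exact: measurable_funP.
  - by move=> Y Z YZ; rewrite -lee_fin EFinM !LE pE LnormM.
  - exact: normZ.
  - exact: norm_ge0.
  - by move=> Y Z YZ; rewrite N_indep.
  - exact: norm_restrict_le.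
  - move=> E mE; rewrite -lee_fin LE pE Lnorm_indic ?invr_eq0// invrK lee_fin.
    have [PE0|PEn0] := eqVneq (prob P E) 0.
      by rewrite PE0 powR0// norm_ge0.
    by rewrite Na// lt_def PEn0 prob_ge0.
(* With [a = 0] every non-null indicator has norm 1, so restricting [X] to the fibre of a value [x]
   of positive probability leaves norm [|x|]. *)
have NX x : prob P (X @^-1` [set x]) != 0 -> `|x| <= N (simpleRV_class P X).
  move=> Px; have mX := measurable_fiber X x.
  apply: le_trans (norm_restrict_le rP N_norm N_law N_indep X mX).
  have -> : X * indic_sfun _ mX = scale_sfun x
    (indic_sfun _ mX) :> {sfun T >-> R}.
    apply/sfuneqP => t; rewrite sfunME scale_sfunE indic_sfunE indicE.
    by have [/set_mem /= ->|] := boolP (t \in _); rewrite ?mulr0.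
  by rewrite normZ// Na ?az ?powRr0 ?mulr1// lt_def Px prob_ge0.
rewrite -lee_fin LE /p az eqxx LnormyE; apply/ess_supP.
(* By [NX], every value of modulus above the norm of [X] has a null fibre; [X] has finitely many
   values, so the norm is an almost sure bound. *)
pose J : set R := [set x | N (simpleRV_class P X) < `|x|].
have mJ : measurable J.
  rewrite (_ : J = ~` [set x | x \in `[- N (simpleRV_class P X),
    N (simpleRV_class P X)]]).
    by apply: measurableC; exact: measurable_itv.
  by apply/seteqP; split=> x; rewrite /J/= in_itv/= -ler_norml ltNge => /negP.
exists (X @^-1` J); split; first exact: measurable_preimage.
  have [s [us sX _]] := sfun_values X.
  apply: etrans (esym (probE P (measurable_preimage X mJ))) _.
  rewrite (prob_preimageT P us sX mJ) big1// => x /set_mem Jx.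
  apply/eqP; apply: contraLR Jx => /NX.
  by rewrite leNgt.
by move=> t /= /negP; rewrite lee_fin -ltNge.
Qed.
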